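(* Let $n\ge 16$ be even and let $W_{4,n}$ be the $4$-regular Kn\''odel graph. Then $W_{4,n}$ is $\gamma$-stable if and only if (i) $n\in\{18,28\}$, or (ii) $n\equiv 0\pmod{10}$ or $n\equiv 4\pmod{10}$, or (iii) $n\ne 26$ and $n\equiv 6\pmod{10}$.
   Context: For an even integer $n\ge 2$ and $1\le\Delta\le\lfloor\log_2 n\rfloor$, the Kn\''odel graph $W_{\Delta,n}$ is the $\Delta$-regular bipartite graph on the $n$ vertices $(i,j)$, $i\in\{1,2\}$, $0\le j\le n/2-1$, in which for every $j$ the vertex $(1,j)$ is adjacent to the vertices $(2,(j+2^k-1)\bmod (n/2))$ for $k=0,1,\dots,\Delta-1$ (and there are no other edges). A set $D$ of vertices of a graph $G$ is dominating if every vertex not in $D$ is adjacent to a vertex of $D$; $\gamma(G)$ is the minimum size of a dominating set. A graph $G$ is $\gamma$-stable if $\gamma(G-u)=\gamma(G)$ for every vertex $u$ of $G$, where $G-u$ is the graph obtained by deleting $u$. *)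

(* Defs.v *)
From mathcomp Require Import all_boot all_order.
Set Implicit Arguments. Unset Strict Implicit. Unset Printing Implicit Defensive.

(* A (simple) graph is given by a finite vertex type T and a symmetric
   adjacency relation adj; subgraphs induced on a vertex set V : {set T}. *)

Definition dominating (T : finType) (adj : rel T) (V D : {set T}) : bool :=
  (D \subset V) &&
  [forall x in V, (x \in D) || [exists y in D, adj x y]].

(* Domination number of the graph induced on V: minimum size of a dominating
   set (V itself is dominating, so #|V| is a valid initial bound). *)
Definition gamma (T : finType) (adj : rel T) (V : {set T}) : nat :=
  \big[minn/#|V|]_(D : {set T} | dominating adj V D) #|D|.

Definition gamma_stable (T : finType) (adj : rel T) : Prop :=
  forall u : T, gamma adj ([set: T] :\ u) = gamma adj [set: T].

(* Knodel graph W_{Delta,n}: vertices (i,j), i in {1,2} encoded as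
   false (=1) / true (=2), j in 'I_(n/2).  (1,j) ~ (2,(j+2^k-1) mod (n/2))
   for k = 0..Delta-1; the relation is symmetrised. *)
Definition knodel_vertex (n : nat) := (bool * 'I_(n./2))%type.

Definition knodel_half (Delta n : nat) (j k : nat) : bool :=
  [exists kk : 'I_Delta, k == (j + 2 ^ kk - 1) %% n./2].

Definition knodel_adj (Delta n : nat) : rel (knodel_vertex n) :=
  fun x y =>
    match x.1, y.1 with
    | false, true => knodel_half Delta n x.2 y.2
    | true, false => knodel_half Delta n y.2 x.2
    | _, _ => false
    end.
Arguments knodel_adj Delta n : clear implicits.

(* Main.v *)
(* Put N = n/2 and encode a vertex set D by the N-periodic sequence of letters
   (is (1,t) in D, is (2,t) in D).  Domination is a condition on 8 consecutive
   letters, so D is a closed walk of length N in an automaton whose states are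
   windows of 7 letters.  Counting dominations beyond the first ("excess") and
   undominated vertices ("defect") gives 5|D| + defect = 2N + excess.
   Walks without excess and defect eventually run through the word "ba..." of
   period 5, which is the perfect code (its windows are called perfect).
   - A walk between perfect windows with defect <= 1 and excess <= 7 has one of
     five possible (defect, excess) pairs, by a finite search.
   - A closed walk avoiding perfect windows can be rotated so that excess and
     defect accumulate at most at the average rate; a finite search then leaves
     only finitely many lengths.
   Hence excess 1, 2, 3, 4, 7 (defect 0) and 0, 2, 3, 5 (defect 1) do not occur,
   up to sporadic N <= 18.  With explicit words whose defect is 0 or 1 this
   decides whether some set of size gamma - 1 misses exactly one vertex, which
   is what instability means. *)

Require Import Defs.
From mathcomp Require Import all_boot all_order.
From mathcomp Require Import zify.

Set Implicit Arguments. Unset Strict Implicit. Unset Printing Implicit Defensive.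

(** * The window automaton *)

Definition letter := (bool * bool)%type.
Definition letters : seq letter :=
  [:: (false, false); (true, false); (false, true); (true, true)].

(* For a window w at t and the letter x at t + 7, [cover2] counts the
   dominators of (2, t + 7) and [cover1] those of (1, t). *)
Definition cover2 (w : seq letter) (x : letter) : nat :=
  let a i := (nth (false, false) w i).1 in x.2 + x.1 + a 6 + a 4 + a 0.
Definition cover1 (w : seq letter) (x : letter) : nat :=
  let b i := (nth (false, false) w i).2 in
  (nth (false, false) w 0).1 + b 0 + b 1 + b 3 + x.2.
Definition excess w x := (cover1 w x).-1 + (cover2 w x).-1.
Definition defect w x : nat := (cover1 w x == 0) + (cover2 w x == 0).
Definition shift (w : seq letter) (x : letter) := rcons (behead w) x.

Definition lo : letter := (false, false).
Definition la : letter := (true, false).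
Definition lb : letter := (false, true).

Definition perfect_windows : seq (seq letter) :=
  [:: [:: lo; lo; lb; la; lo; lo; lo]; [:: lo; lb; la; lo; lo; lo; lb];
      [:: lb; la; lo; lo; lo; lb; la]; [:: la; lo; lo; lo; lb; la; lo];
      [:: lo; lo; lo; lb; la; lo; lo]].
Definition perfect w := w \in perfect_windows.

(* Follows all walks from w whose running totals d (defect) and e (excess)
   satisfy the successive bounds in [live]; [final] is tested at the first
   perfect window, [last] when the bounds are exhausted. *)
Fixpoint explore (last : pred (seq letter)) (final : nat -> nat -> bool)
    (live : seq (nat -> nat -> bool)) (w : seq letter) (d e : nat) : bool :=
  if live is l :: live' then
    all (fun x =>
      let d' := d + defect w x in let e' := e + excess w x in
      let w' := shift w x in
      if ~~ l d' e' then true else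
      if perfect w' then final d' e' else explore last final live' w' d' e')
      letters
  else last w.

Definition return_costs : seq (nat * nat) :=
  [:: (0, 0); (0, 5); (0, 6); (1, 4); (1, 7)].

Definition excursions_check : bool :=
  all (fun w => all (fun p =>
    explore pred0 (fun d e => (d, e) \in return_costs)
      (nseq 60 (fun d e => (d <= 1) && (e <= 7))) w p.1 p.2)
    return_costs) perfect_windows.


Definition excess_classes : seq (nat * nat) :=
  [:: (0, 1); (0, 2); (0, 3); (0, 4); (0, 7); (1, 0); (1, 2); (1, 3); (1, 5)].
(* Triples (N, (defect, excess)) with a closed walk avoiding perfect windows; for
   (18, (1, 5)) the balanced search only finds the walk counted in (18, (0, 4)). *)
Definition sporadic : seq (nat * (nat * nat)) :=
  [:: (8, (0, 4)); (9, (0, 2)); (9, (0, 7)); (14, (0, 7)); (18, (0, 4));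
      (8, (1, 5)); (9, (1, 3)); (13, (1, 5)); (18, (1, 5))].
Definition excluded (p : nat * (nat * nat)) : bool :=
  (p.2 \in excess_classes) && (p \notin sporadic).
Definition small_cases : seq (nat * (nat * nat)) :=
  [seq p <- [seq (N, p) | N <- iota 8 26, p <- excess_classes]
     | excluded p & (2 * p.1 + p.2.2) %% 5 == p.2.1].

Definition balanced (N d0 W : nat) : seq (nat -> nat -> bool) :=
  [seq (let b := W * t %/ N in fun d e => (d + e <= b) && (d <= d0)) | t <- iota 1 N].

Fixpoint all_words (n : nat) (P : pred (seq letter)) : bool :=
  if n is m.+1 then all (fun x => all_words m (fun w => P (x :: w))) letters
  else P [::].

(* The two free steps are the start of a balanced walk with 2W < N; they
   discard most windows cheaply.  From N = 34 on, the slope 7/34 bounds W/N and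
   no balanced walk survives 34 steps without meeting a perfect window. *)
Definition window_check (w : seq letter) : bool :=
  if perfect w then true else
  if explore pred0 (fun _ _ => true) (nseq 2 (fun d e => d + e == 0)) w 0 0 then true else
  explore pred0 (fun _ _ => true) (balanced 34 1 7) w 0 0 &&
  all (fun p => explore (fun w' => w' != w) (fun _ _ => true)
                  (balanced p.1 p.2.1 (p.2.1 + p.2.2)) w 0 0) small_cases.

Lemma excursions_checked : excursions_check.
Proof. by vm_compute. Qed.

Lemma windows_checked : all_words 7 window_check.
Proof. by vm_compute. Qed.

Lemma small_cases_slope : all (fun p => 2 * (p.2.1 + p.2.2) < p.1) small_cases.
Proof. by vm_compute. Qed.

Lemma all_wordsP (n : nat) (P : pred (seq letter)) (w : seq letter) :
  all_words n P -> size w = n -> P w.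
Proof.
elim: n P w => [|n IHn] P [|x w] //= H [sz_w].
have {H} : all_words n (fun w => P (x :: w)).
  by move: H; case: x => -[] [] /and5P[].
by move/IHn; apply.
Qed.


Definition psum (f : nat -> nat) (s n : nat) : nat := \sum_(i < n) f (s + i).

Lemma psum0 f s : psum f s 0 = 0.
Proof. by rewrite /psum big_ord0. Qed.

Lemma psumS f s n : psum f s n.+1 = f s + psum f s.+1 n.
Proof.
by rewrite /psum big_ord_recl addn0; congr addn; apply: eq_bigr => i _; rewrite addSnnS.
Qed.

Lemma psumD f s m n : psum f s (m + n) = psum f s m + psum f (s + m) n.
Proof.
elim: m s => [|m IHm] s; first by rewrite psum0 addn0.
by rewrite addSn !psumS IHm addSnnS addnA.
Qed.

Lemma leq_psum f s m n : m <= n -> psum f s m <= psum f s n.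
Proof. by move=> /subnKC <-; rewrite psumD leq_addr. Qed.

Lemma psum_add f g s n :
  psum (fun t => f t + g t) s n = psum f s n + psum g s n.
Proof. exact: big_split. Qed.

Definition periodic (T : Type) (N : nat) (f : nat -> T) := forall t, f (t + N) = f t.

Lemma periodic_mod (T : Type) N (f : nat -> T) t : periodic N f -> f (t %% N) = f t.
Proof.
move=> perf; rewrite [in RHS](divn_eq t N); elim: (t %/ N) => [//|k IHk].
by rewrite mulSn -addnA addnC perf.
Qed.

Lemma psum_period N f s : periodic N f -> psum f s N = psum f 0 N.
Proof.
move=> perf; elim: s => // s <-.
have := psumS f s N; rewrite -addn1 psumD psumS psum0 addn0 perf; lia.
Qed.

(* The cycle lemma, cut at the largest deviation above the average slope. *)
Lemma balanced_rotation N f : 0 < N -> periodic N f ->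
  exists s, forall t, t <= N -> N * psum f s t <= psum f 0 N * t.
Proof.
move=> N_gt0 perf; set W := psum f 0 N.
pose dev i := N * psum f 0 i + W * (N - i).
have /= := @arg_maxnP _ (Ordinal N_gt0) xpredT (fun i => dev i) isT.
case: arg_maxnP => // i _ maxi _; exists i => t le_tN.
have lt_iN := ltn_ord i.
have split_i := psumD f 0 i t; rewrite add0n in split_i.
have [lt_it | le_Nit] := ltnP (i + t) N.
  have := maxi (Ordinal lt_it) isT; rewrite /dev /= split_i; nia.
pose j := i + t - N.
have lt_j : j < N by rewrite /j; lia.
have Ej : psum f 0 (i + t) = W + psum f 0 j.
  have -> : i + t = j + N by rewrite /j; lia.
  by rewrite psumD psum_period // addnC.
have := maxi (Ordinal lt_j) isT; rewrite /dev /= => le_dev.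
have Eit : i + t = j + N by rewrite /j; lia.
nia.
Qed.

Lemma exploreS last final l live w d e x :
    explore last final (l :: live) w d e ->
    l (d + defect w x) (e + excess w x) ->
  if perfect (shift w x) then final (d + defect w x) (e + excess w x)
  else explore last final live (shift w x) (d + defect w x) (e + excess w x).
Proof.
move=> /allP/(_ x); have -> : x \in letters by case: x => -[] [].
by move=> /(_ isT) + Hl; cbv beta zeta; rewrite Hl.
Qed.

(** * Walks *)

Section Walks.
Variable c : nat -> letter.

Definition window (t : nat) : seq letter := map c (iota t 7).
Definition excess_at t := excess (window t) (c (t + 7)).
Definition defect_at t := defect (window t) (c (t + 7)).

Lemma shift_window t : shift (window t) (c (t + 7)) = window t.+1.
Proof. by rewrite /window /shift /= !addnS addn0. Qed.

Lemma exploreP last final live s n d e :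
    explore last final live (window s) d e -> n <= size live ->
    (forall i, i < n -> nth (fun _ _ => true) live i
       (d + psum defect_at s i.+1) (e + psum excess_at s i.+1)) ->
    (forall i, 0 < i < n -> ~~ perfect (window (s + i))) ->
  [/\ 0 < n -> perfect (window (s + n)) ->
        final (d + psum defect_at s n) (e + psum excess_at s n)
    & n = size live -> ~~ perfect (window (s + n)) || (n == 0) ->
        last (window (s + n))].
Proof.
elim: live s n d e => [|l live IHl] s [|n] d e.
- by rewrite addn0.
- by [].
- by move=> _ _ _ _; split.
- move=> Hx lt_n Hl Hperf.
  have := exploreS (x := c (s + 7)) Hx.
  rewrite -/(defect_at s) -/(excess_at s) shift_window.
  have Hl0 := Hl 0 isT; rewrite !psumS !psum0 !addn0 /= in Hl0.
  move=> /(_ Hl0).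
  case: n lt_n Hl Hperf => [|n] lt_n Hl Hperf.
    rewrite !psumS !psum0 !addn0 addn1.
    case: ifP => [_ H | _ H]; split=> // - [sz0] _; move: H.
    by case: live sz0 {IHl Hx Hl lt_n}.
  have /negPf-> : ~~ perfect (window s.+1) by rewrite -addn1 Hperf.
  move=> /IHl/(_ (lt_n : n.+1 <= size live)) [|i /andP[i_gt0 lt_i]|H1 H2].
  + by move=> i lt_in; have := Hl i.+1 lt_in; rewrite !(psumS _ s) !addnA.
  + by rewrite addSnnS Hperf //=; lia.
  + rewrite !(psumS _ s n.+1) -[s + n.+2]addSnnS (addnA d) (addnA e).
    split=> [_ | [Hs]]; first exact: H1.
    by rewrite orbF => np; apply: H2; rewrite ?np.
Qed.
End Walks.

Lemma perfect_return c (s n d e : nat) :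
    (d, e) \in return_costs ->
    perfect (window c s) -> perfect (window c (s + n)) ->
    d + psum (defect_at c) s n <= 1 -> e + psum (excess_at c) s n <= 7 ->
  (d + psum (defect_at c) s n, e + psum (excess_at c) s n) \in return_costs.
Proof.
have [m] := ubnP n; elim: m n s d e => // m IHm n s d e le_nm de_ok ps pn D1 E7.
have [->|n_gt0] := posnP n; first by rewrite !psum0 !addn0.
have ex_r : exists k, (0 < k) && perfect (window c (s + k)) by exists n; rewrite n_gt0.
have [r /andP[r_gt0 pr] min_r] := ex_minnP ex_r.
have le_rn : r <= n by rewrite min_r ?n_gt0.
have X := allP (allP excursions_checked _ ps) _ de_ok.
have [|i lt_i|i i_bd|fin las] := exploreP (n := minn r 60) X.
- by rewrite size_nseq geq_minr.
- have le_in : i.+1 <= n by lia.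
  have := leq_psum (defect_at c) s le_in; have := leq_psum (excess_at c) s le_in.
  by rewrite nth_nseq; case: ifP => //= _ leE leD; apply/andP; split; lia.
- case/andP: i_bd => i_gt0 lt_i; apply: contraT => /negPn pi; have := min_r i; rewrite i_gt0 pi => /(_ isT); lia.
have [le_r60|lt_60r] := leqP r 60; last first.
  have E60 : minn r 60 = 60 by lia.
  rewrite E60 size_nseq orbF in las.
  suff np : ~~ perfect (window c (s + 60)) by have := las (erefl _) np.
  by apply: contraL lt_60r => p60; rewrite -leqNgt min_r.
rewrite (minn_idPl le_r60) in fin; have := fin r_gt0 pr => {fin las} fin.
move: D1 E7 pn; rewrite -(subnKC le_rn) !psumD !addnA => D1 E7 pn.
by apply: IHm => //; lia.
Qed.

Lemma closed_walk_excluded c N :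
    8 <= N -> periodic N c ->
    (2 * N + psum (excess_at c) 0 N) %% 5 = psum (defect_at c) 0 N ->
  ~~ excluded (N, (psum (defect_at c) 0 N, psum (excess_at c) 0 N)).
Proof.
move=> N_ge8 perc; set E := psum (excess_at c) 0 N; set D := psum _ 0 N => DE5.
apply/negP => exc.
have N_gt0 : 0 < N by lia.
have DE_class : (D, E) \in excess_classes by case/andP: exc.
have class_bound :
  all (fun p : nat * nat => (p.1 <= 1) && (p.1 + p.2 <= 7)) excess_classes by [].
have /andP[/= D1 W7] := allP class_bound _ DE_class.
have perw t : window c (t + N) = window c t.
  by rewrite /window /= -!addSn !perc.
have perD : periodic N (defect_at c).
  by move=> t; rewrite /defect_at perw addnAC perc.
have perE : periodic N (excess_at c).
  by move=> t; rewrite /excess_at perw addnAC perc.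
have [/existsP[t pt] | /existsPn np] :=
    boolP [exists t : 'I_N, perfect (window c t)].
  have := @perfect_return c t N 0 0 isT pt; rewrite perw !psum_period // !add0n.
  move=> /(_ pt); rewrite -/D -/E => /(_ D1) ret.
  have no_return : all (fun p => p \notin return_costs) excess_classes by [].
  by have /negP := allP no_return _ DE_class; apply; apply: ret; lia.
have {}np t : ~~ perfect (window c t).
  by rewrite -(periodic_mod (N := N) t) //; exact: (np (Ordinal (ltn_pmod t N_gt0))).
pose f t := defect_at c t + excess_at c t.
have perf : periodic N f by move=> t; rewrite /f perD perE.
have [s] := balanced_rotation N_gt0 perf.
have fDE s' n : psum f s' n = psum (defect_at c) s' n + psum (excess_at c) s' n.
  exact: psum_add.
rewrite fDE -/D -/E => bal.
have slope : N < 34 -> (N, (D, E)) \in small_cases.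
  move=> ltN; rewrite mem_filter; apply/andP; split; first by rewrite exc /= DE5.
  by apply: (@allpairs_f _ _ _ pair) => //; rewrite mem_iota; lia.
have W2N : 2 * (D + E) < N.
  have [/slope|] := ltnP N 34; last by lia.
  by move/(allP small_cases_slope).
have DEs n : n <= N -> psum (defect_at c) s n <= D.
  by move=> le_nN; rewrite -[D](psum_period s) ?leq_psum.
have := all_wordsP (w := window c s) windows_checked (erefl _).
rewrite /window_check (negPf (np s)).
case: ifP => [X _|_ /andP[X34 /allP Xs]].
  have [|i lt_i|i _|_ las] := exploreP (n := 2) X; rewrite ?np //.
    have le_iN : i.+1 <= N by lia.
    have := bal _ le_iN; rewrite fDE.
    by case: i lt_i le_iN => [|[|]] //= _ _; nia.
  by have := las (erefl _); rewrite np => /(_ isT).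
have [ltN | leN] := ltnP N 34.
  have X : explore _ _ (balanced N D (D + E)) _ 0 0 := Xs _ (slope ltN).
  have [|i lt_i|i _|_ las] := exploreP (n := N) X; rewrite ?np //.
  - by rewrite size_map size_iota.
  - rewrite (nth_map 0) ?size_iota // nth_iota // !add0n add1n.
    by cbv beta zeta; rewrite DEs // andbT leq_divRL // mulnC -fDE bal.
  - by have := las; rewrite size_map size_iota perw np eqxx => /(_ (erefl _) isT).
have [|i lt_i|i _|_ las] := exploreP (n := 34) X34; rewrite ?np //.
  rewrite (nth_map 0) ?size_iota // nth_iota // !add0n add1n.
  have le_iN : i.+1 <= N by lia.
  have := DEs _ le_iN; have := bal _ le_iN; rewrite fDE => balN leD.
  cbv beta zeta; rewrite leq_divRL //; apply/andP; split; [nia | lia].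
by have := las (erefl _); rewrite np => /(_ isT).
Qed.

Lemma psum_shift N f k : periodic N f -> psum (fun t => f (t + k)) 0 N = psum f 0 N.
Proof.
move=> perf; rewrite -(psum_period k perf).
by apply: eq_bigr => i _; rewrite add0n addnC.
Qed.

Lemma eq_psum f g s n : f =1 g -> psum f s n = psum g s n.
Proof. by move=> fg; apply: eq_bigr => i _. Qed.

(** * Vertex sets as periodic walks *)

Section Count.
Variables (c : nat -> letter) (N : nat).
Hypothesis perc : periodic N c.

Lemma cover2_window t : cover2 (window c t) (c (t + 7)) =
  (c (t + 7)).2 + (c (t + 7)).1 + (c (t + 6)).1 + (c (t + 4)).1 + (c t).1.
Proof. by rewrite /cover2 /window /= !addnS !addn0. Qed.

Lemma cover1_window t : cover1 (window c t) (c (t + 7)) =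
  (c t).1 + (c t).2 + (c (t + 1)).2 + (c (t + 3)).2 + (c (t + 7)).2.
Proof. by rewrite /cover1 /window /= !addnS !addn0. Qed.

Definition weight (x : letter) : nat := x.1 + x.2.

Lemma weight_balance :
  5 * psum (weight \o c) 0 N + psum (defect_at c) 0 N
    = 2 * N + psum (excess_at c) 0 N.
Proof.
have perg (g : letter -> nat) k :
    psum (fun t => g (c (t + k))) 0 N = psum (g \o c) 0 N.
  by apply: (@psum_shift N (g \o c)) => t; rewrite /= perc.
pose p1 (x : letter) : nat := x.1; pose p2 (x : letter) : nat := x.2.
have -> : psum (weight \o c) 0 N = psum (p1 \o c) 0 N + psum (p2 \o c) 0 N.
  exact: psum_add.
have sum1 : psum (fun t => cover1 (window c t) (c (t + 7))) 0 N
    = psum (p1 \o c) 0 N + 4 * psum (p2 \o c) 0 N.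
  rewrite (eq_psum _ _ cover1_window) !psum_add !(perg p2).
  rewrite -[X in X + _ + _ + _ + _]/(psum (p1 \o c) 0 N).
  rewrite -[X in _ + X + _ + _ + _]/(psum (p2 \o c) 0 N); lia.
have sum2 : psum (fun t => cover2 (window c t) (c (t + 7))) 0 N
    = 4 * psum (p1 \o c) 0 N + psum (p2 \o c) 0 N.
  rewrite (eq_psum _ _ cover2_window) !psum_add !(perg p2) !(perg p1).
  rewrite -[X in _ + X]/(psum (p1 \o c) 0 N); lia.
transitivity (psum (fun t => cover1 (window c t) (c (t + 7))
                 + cover2 (window c t) (c (t + 7)) + defect_at c t) 0 N).
  by rewrite 2!psum_add sum1 sum2; lia.
transitivity (psum (fun t => 2 + excess_at c t) 0 N); last first.
  by rewrite psum_add /psum sum_nat_const card_ord mulnC.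
apply: eq_psum => t; rewrite /defect_at /excess_at /defect /excess.
by case: (cover1 _ _) (cover2 _ _) => [|x] [|y] /=; lia.
Qed.
End Count.

Definition undominated (T : finType) (adj : rel T) (D : {set T}) : {set T} :=
  [set x | ~~ ((x \in D) || [exists y in D, adj x y])].

Section Knodel.
Variable n : nat.
Hypothesis N_gt0 : 0 < n./2.
Implicit Type D : {set knodel_vertex n}.

Definition vertex (s : bool) (t : nat) : knodel_vertex n :=
  (s, Ordinal (ltn_pmod t N_gt0)).

Lemma vertexE (x : knodel_vertex n) : x = vertex x.1 x.2.
Proof. by case: x => s i; congr pair; apply: val_inj; rewrite /= modn_small. Qed.

Lemma eq_vertex s t u : t = u %[mod n./2] -> vertex s t = vertex s u.
Proof. by move=> eq_tu; congr pair; apply: val_inj. Qed.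

Lemma periodic_vertex s : periodic n./2 (vertex s).
Proof. by move=> t; apply: eq_vertex; rewrite modnDr. Qed.

Lemma knodel_halfE j k :
  knodel_half 4 n (j %% n./2) (k %% n./2)
    = has (fun i => k == j + i %[mod n./2]) [:: 0; 1; 3; 7].
Proof.
have E i : 0 < 2 ^ i by rewrite expn_gt0.
apply/existsP/hasP => [[i]|[i]].
  rewrite -addnBA // modnDml => kE; exists (2 ^ i - 1) => //.
  by case: i {kE} => -[|[|[|[|]]]].
rewrite !inE => i_in kE.
suff [l lE] : exists l : 'I_4, i = 2 ^ l - 1.
  by exists l; rewrite -addnBA // modnDml -lE.
case/or4P: i_in => /eqP->; [exists (inord 0)|exists (inord 1)|exists (inord 2)|exists (inord 3)];
  by rewrite inordK.
Qed.

Lemma adj_vertex12 j k :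
  knodel_adj 4 n (vertex false j) (vertex true k)
    = has (fun i => k == j + i %[mod n./2]) [:: 0; 1; 3; 7].
Proof. exact: knodel_halfE. Qed.

Lemma adj_vertex21 j k :
  knodel_adj 4 n (vertex true k) (vertex false j)
    = has (fun i => k == j + i %[mod n./2]) [:: 0; 1; 3; 7].
Proof. exact: knodel_halfE. Qed.

Lemma neighbour1 D t :
  [exists y in D, knodel_adj 4 n (vertex false t) y]
    = has (fun i => vertex true (t + i) \in D) [:: 0; 1; 3; 7].
Proof.
apply/exists_inP/hasP => [[y yD]|[i i_in iD]].
  case: y yD => -[] k; rewrite [(_, k)]vertexE //= => kD.
  rewrite adj_vertex12 => /hasP[i i_in /eqP kE].
  by exists i => //; rewrite -(eq_vertex true kE).
exists (vertex true (t + i)) => //.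
by rewrite adj_vertex12; apply/hasP; exists i.
Qed.

Lemma neighbour2 D t :
  [exists y in D, knodel_adj 4 n (vertex true (t + 7)) y]
    = has (fun i => vertex false (t + i) \in D) [:: 7; 6; 4; 0].
Proof.
apply/exists_inP/hasP => [[y yD]|[i i_in iD]].
  case: y yD => -[] k; rewrite [(_, k)]vertexE //= => kD.
  rewrite adj_vertex21 => /hasP[i i_in kE].
  have le_i7 : i <= 7 by move: i_in; rewrite !inE => /or4P[] /eqP->.
  exists (7 - i); first by move: i_in; rewrite !inE => /or4P[] /eqP->.
  rewrite (_ : vertex false _ = vertex false k) //; apply/eq_vertex/eqP.
  by rewrite -(eqn_modDr i) -addnA subnK.
exists (vertex false (t + i)) => //.
rewrite adj_vertex21; apply/hasP; exists (7 - i).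
  by move: i_in; rewrite !inE => /or4P[] /eqP->.
have le_i7 : i <= 7 by move: i_in; rewrite !inE => /or4P[] /eqP->.
by rewrite -addnA subnKC.
Qed.

Definition letter_of D (t : nat) : letter := (vertex false t \in D, vertex true t \in D).

Lemma periodic_letter_of D : periodic n./2 (letter_of D).
Proof. by move=> t; rewrite /letter_of !periodic_vertex. Qed.

Lemma card_psum D : #|D| = psum (weight \o letter_of D) 0 n./2.
Proof.
rewrite -sum1_card big_mkcond /=.
transitivity (\sum_(s : bool) \sum_(i < n./2) ((s, i) \in D : nat)).
  by rewrite pair_bigA /=; apply: eq_bigr => -[s i] _ /=; case: (_ \in _).
rewrite big_bool /= addnC -big_split /=; apply: eq_bigr => i _.
by rewrite add0n /weight /= -!(vertexE (_, i)).
Qed.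

Lemma card_undominated D :
  #|undominated (knodel_adj 4 n) D| = psum (defect_at (letter_of D)) 0 n./2.
Proof.
set U := undominated _ D.
rewrite card_psum /weight.
pose f s t : nat := vertex s t \in U.
have perf s : periodic n./2 (f s) by move=> t; rewrite /f periodic_vertex.
rewrite (@eq_psum _ (fun t => f false t + f true t)) // psum_add.
rewrite -(psum_shift 7 (perf true)) -psum_add; apply: eq_psum => t.
rewrite /defect_at /defect cover1_window cover2_window.
rewrite /f !inE neighbour1 neighbour2 /letter_of /= !addn0.
congr addn; do 5!case: (_ \in D) => //=.
Qed.

Lemma domination_excluded D : 8 <= n./2 ->
  exists e, [/\ 5 * #|D| + #|undominated (knodel_adj 4 n) D| = n./2 * 2 + e
    & ~~ excluded (n./2, (#|undominated (knodel_adj 4 n) D|, e))].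
Proof.
move=> N_ge8; exists (psum (excess_at (letter_of D)) 0 n./2).
have perc := periodic_letter_of D.
have bal := weight_balance perc.
rewrite card_undominated card_psum; split; first by rewrite bal mulnC.
have [D_le1 | D_gt1] := leqP (psum (defect_at (letter_of D)) 0 n./2) 1.
  apply: closed_walk_excluded => //; lia.
rewrite /excluded !inE !xpair_eqE /=.
by case: (psum (defect_at _) _ _) D_gt1 => [|[|]].
Qed.
End Knodel.

(** * Domination numbers and stability *)

Section Gamma.
Variables (T : finType) (adj : rel T).
Implicit Types (V D : {set T}) (u : T).

Lemma gamma_le V D : dominating adj V D -> gamma adj V <= #|D|.
Proof.
rewrite /gamma -[index_enum _]/(index_enum {set T}) => domD.
have := mem_index_enum D; elim: (index_enum _) => //= A s IHs.
rewrite inE big_cons; case: eqP => [<- _ | _ /= /IHs le_s]; first by rewrite domD geq_minl.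
by case: ifP => // _; rewrite geq_min le_s orbT.
Qed.

Lemma leq_gamma V m :
  (forall D, dominating adj V D -> m <= #|D|) -> m <= gamma adj V.
Proof.
move=> lb; rewrite /gamma; elim/big_ind: _ => [||D]; last exact: lb.
  apply: lb; apply/andP; split=> //.
  by apply/forall_inP => x ->.
by move=> k l mk ml; rewrite leq_min mk.
Qed.

Lemma dominating_setT D : dominating adj setT D = (undominated adj D == set0).
Proof.
rewrite /dominating subsetT /=; apply/forall_inP/eqP => [H | U0 x _].
  by apply/setP => x; rewrite !inE; apply/negbTE; rewrite negbK H.
by apply: contraT => Hx; move/setP/(_ x): U0; rewrite !inE Hx.
Qed.

Lemma dominating_setD1 D u :
  dominating adj (setT :\ u) D = (u \notin D) && (undominated adj D \subset [set u]).
Proof.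
rewrite /dominating subsetD1 subsetT /=; congr andb.
apply/forall_inP/subsetP => [H x | H x].
  by rewrite !inE; apply: contraNT => xu; rewrite H // !inE xu.
rewrite !inE andbT => xu; apply: contraT => Hx.
by have := H x; rewrite !inE Hx (negPf xu) => /(_ isT).
Qed.

Lemma gamma_stable_of_bounds m :
    (forall D, #|undominated adj D| <= 1 -> m <= #|D|) ->
    (forall u, exists D, [/\ undominated adj D = set0, u \notin D & #|D| <= m]) ->
  gamma_stable adj.
Proof.
move=> lb ub u; have [D [U0 uD Dm]] := ub u.
have gT : gamma adj setT = m.
  apply/eqP; rewrite eqn_leq (leq_trans (gamma_le (D := D) _)) //=.
    by apply: leq_gamma => E; rewrite dominating_setT => /eqP U; rewrite lb ?U ?cards0.
  by rewrite dominating_setT U0.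
rewrite gT; apply/eqP; rewrite eqn_leq (leq_trans (gamma_le (D := D) _)) //=.
  apply: leq_gamma => E; rewrite dominating_setD1 => /andP[_ U]; apply: lb.
  by rewrite -(cards1 u) subset_leq_card.
by rewrite dominating_setD1 U0 sub0set uD.
Qed.

Lemma not_gamma_stable D :
    #|undominated adj D| = 1 ->
    (forall D', undominated adj D' = set0 -> #|D| < #|D'|) ->
  ~ gamma_stable adj.
Proof.
move=> /eqP/cards1P[u U] lb /(_ u).
have uD : u \notin D.
  by have := set11 u; rewrite -U inE negb_or => /andP[].
have : gamma adj (setT :\ u) <= #|D|.
  by apply: gamma_le; rewrite dominating_setD1 uD U subxx.
move=> le_g eq_g; move: le_g; rewrite eq_g leqNgt => /negP; apply.
by apply: leq_gamma => E; rewrite dominating_setT => /eqP/lb.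
Qed.
End Gamma.

(** * Cyclic words *)

Fixpoint word_defects (w v : seq letter) : nat :=
  if v is x :: v' then defect w x + word_defects (shift w x) v' else 0.

Lemma word_defectsE c s k :
  word_defects (window c s) (map c (iota (s + 7) k)) = psum (defect_at c) s k.
Proof.
elim: k s => [|k IHk] s; first by rewrite psum0.
by rewrite psumS -IHk /= shift_window addSn.
Qed.

Definition necklace (L : seq letter) (t : nat) : letter := nth lo L (t %% size L).

Lemma map_necklace L k m :
  m <= size L -> [seq necklace L t | t <- iota (k * size L) m] = take m L.
Proof.
move=> le_mL; apply: (@eq_from_nth _ lo).
  by rewrite size_map size_iota size_takel.
rewrite size_map size_iota => i lt_im.
rewrite (nth_map 0) ?size_iota // nth_iota // nth_take // /necklace.
by rewrite modnMDl modn_small //; lia.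
Qed.

Lemma necklace_defects w v : size w = 7 ->
  psum (defect_at (necklace (w ++ v))) 0 (size (w ++ v)) = word_defects w (v ++ w).
Proof.
move=> sz_w; rewrite -word_defectsE.
have sz : size (w ++ v) = 7 + size v by rewrite size_cat sz_w.
have -> : window (necklace (w ++ v)) 0 = w.
  rewrite /window -[iota 0 7]/(iota (0 * size (w ++ v)) 7) map_necklace.
    by rewrite -sz_w take_size_cat.
  by rewrite sz leq_addr.
congr word_defects; rewrite sz add0n (addnC 7) iotaD map_cat; congr cat.
  apply: (@eq_from_nth _ lo); rewrite size_map size_iota // => i lt_i.
  rewrite (nth_map 0) ?size_iota // nth_iota // /necklace sz modn_small; last lia.
  by rewrite nth_cat sz_w ltnNge leq_addr /= addKn.
rewrite -sz -{1}[size (w ++ v)]mul1n map_necklace.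
  by rewrite -sz_w take_size_cat.
by rewrite sz leq_addr.
Qed.

Lemma necklace_weight L : psum (weight \o necklace L) 0 (size L) = sumn (map weight L).
Proof.
rewrite sumnE big_map (big_nth lo) big_mkord; apply: eq_bigr => i _.
by rewrite add0n /= /necklace modn_small.
Qed.

Lemma periodic_necklace L : periodic (size L) (necklace L).
Proof. by move=> t; rewrite /necklace modnDr. Qed.

Section WordSets.
Variables (n : nat) (w v : seq letter).
Hypotheses (size_w : size w = 7) (size_wv : size (w ++ v) = n./2).

Let N_gt0 : 0 < n./2.
Proof. by rewrite -size_wv size_cat size_w. Qed.

Definition word_set (s : nat) : {set knodel_vertex n} :=
  [set x : knodel_vertex n | let l := necklace (w ++ v) (x.2 + s) in if x.1 then l.2 else l.1].

Lemma letter_of_word_set s t :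
  letter_of N_gt0 (word_set s) t = necklace (w ++ v) (t + s).
Proof.
rewrite /letter_of !inE /= /necklace size_wv modnDml.
by case: (nth _ _ _).
Qed.

Lemma card_word_set s : #|word_set s| = sumn (map weight (w ++ v)).
Proof.
rewrite (card_psum N_gt0) -necklace_weight size_wv.
rewrite -(@psum_shift _ (weight \o necklace (w ++ v)) s).
  by apply: eq_psum => t; rewrite /= letter_of_word_set.
by move=> t; rewrite /= -size_wv periodic_necklace.
Qed.

Lemma card_undominated_word_set s :
  #|undominated (knodel_adj 4 n) (word_set s)| = word_defects w (v ++ w).
Proof.
rewrite (card_undominated N_gt0) -necklace_defects // size_wv.
rewrite -(@psum_shift _ (defect_at (necklace (w ++ v))) s).
  apply: eq_psum => t; rewrite /defect_at letter_of_word_set addnAC; congr defect.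
  rewrite /window -[t + s]addn0 iotaDl -map_comp -[t in iota t _]addn0 iotaDl -map_comp.
  by apply: eq_map => i /=; rewrite letter_of_word_set addnAC.
move=> t; rewrite -size_wv /defect_at addnAC periodic_necklace; congr defect.
by rewrite /window /= -!addSn !periodic_necklace.
Qed.

Lemma knodel_stable m :
    8 <= n./2 ->
    word_defects w (v ++ w) = 0 -> sumn (map weight (w ++ v)) = m -> lo \in w ->
    (forall k d e, d <= 1 -> 5 * k + d = n./2 * 2 + e ->
       ~~ excluded (n./2, (d, e)) -> m <= k) ->
  gamma_stable (knodel_adj 4 n).
Proof.
move=> N_ge8 def0 wt_m lo_w lb; apply: (@gamma_stable_of_bounds _ _ m) => [D U1 | [b i]].
  by have [e [eqD exD]] := domination_excluded N_gt0 D N_ge8; apply: lb eqD exD.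
exists (word_set (index lo w + (n./2 - i))); split.
- by apply/eqP; rewrite -cards_eq0 card_undominated_word_set def0.
- have lt_lo : index lo w < 7 by rewrite -size_w index_mem.
  rewrite inE /= /necklace size_wv.
  have -> : i + (index lo w + (n./2 - i)) = index lo w + n./2.
    by have := ltn_ord i; lia.
  rewrite modnDr modn_small; last lia.
  by rewrite nth_cat size_w lt_lo nth_index //; case: b.
- by rewrite card_word_set wt_m.
Qed.

Lemma knodel_unstable :
    8 <= n./2 -> word_defects w (v ++ w) = 1 ->
    (forall k e, 5 * k = n./2 * 2 + e -> ~~ excluded (n./2, (0, e)) ->
       sumn (map weight (w ++ v)) < k) ->
  ~ gamma_stable (knodel_adj 4 n).
Proof.
move=> N_ge8 def1 lb; apply: (@not_gamma_stable _ _ (word_set 0)).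
  by rewrite card_undominated_word_set.
move=> D U0; rewrite card_word_set.
have [e] := domination_excluded N_gt0 D N_ge8.
by rewrite U0 cards0 addn0 => -[]; apply: lb.
Qed.
End WordSets.

Definition perfect_window : seq letter := [:: lo; lo; lb; la; lo; lo; lo].
Definition perfect_run (m : nat) (x : seq letter) : seq letter :=
  flatten (nseq m [:: lb; la; lo; lo; lo]) ++ x.

Lemma perfect_run_defects m x :
  word_defects perfect_window (perfect_run m x) = word_defects perfect_window x.
Proof. by elim: m => //= m; rewrite add0n. Qed.

Lemma size_perfect_run m x : size (perfect_run m x) = 5 * m + size x.
Proof.
by rewrite size_cat size_flatten /shape map_nseq sumn_nseq.
Qed.

Lemma weight_perfect_run m x :
  sumn (map weight (perfect_run m x)) = 2 * m + sumn (map weight x).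
Proof. by elim: m => //= m ->; rewrite mulnS !add0n. Qed.

(** * Stability of the Knodel graphs *)

Lemma excluded_regular (N d e : nat) : N \notin [:: 8; 9; 13; 14; 18] ->
  excluded (N, (d, e)) =
    if d == 0 then e \in [:: 1; 2; 3; 4; 7] else (d == 1) && (e \in [:: 0; 2; 3; 5]).
Proof.
move=> regN.
have /allP sub : all (fun p => p.1 \in [:: 8; 9; 13; 14; 18]) sporadic by [].
rewrite /excluded (contra (sub (N, (d, e))) regN) andbT.
by case: d => [|[|d]]; rewrite !inE !xpair_eqE /= ?orbF.
Qed.

Definition size_excluded (N m d : nat) : bool :=
  all (fun k => (5 * k + d < N * 2) || excluded (N, (d, 5 * k + d - N * 2))) (iota 0 m).

Lemma size_excludedP N m d k e : size_excluded N m d ->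
  5 * k + d = N * 2 + e -> ~~ excluded (N, (d, e)) -> m <= k.
Proof.
move=> /allP chk eq_k; apply: contraNT; rewrite -ltnNge => lt_km.
have := chk k; rewrite mem_iota lt_km => /(_ isT) /orP[|]; first lia.
by rewrite eq_k addKn.
Qed.

Lemma knodel_stable_sporadic n w v : size w = 7 ->
    size (w ++ v) = n./2 -> 8 <= n./2 ->
    word_defects w (v ++ w) = 0 -> lo \in w ->
    size_excluded n./2 (sumn (map weight (w ++ v))) 0 ->
    size_excluded n./2 (sumn (map weight (w ++ v))) 1 ->
  gamma_stable (knodel_adj 4 n).
Proof.
move=> sz_w sz_wv N_ge8 def0 lo_w ex0 ex1.
apply: (knodel_stable sz_w sz_wv) => // k [|[|d]] e // _; exact: size_excludedP.
Qed.

Lemma knodel_stable_family n m x :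
    n./2 = 7 + (5 * m + size x) -> 8 <= n./2 ->
    word_defects perfect_window (x ++ perfect_window) = 0 ->
    (forall k d e, d <= 1 -> 5 * k + d = n./2 * 2 + e ->
       ~~ excluded (n./2, (d, e)) -> 2 + (2 * m + sumn (map weight x)) <= k) ->
  gamma_stable (knodel_adj 4 n).
Proof.
move=> sz N_ge8 def0 lb.
apply: (@knodel_stable n perfect_window (perfect_run m x)) lb => //.
- by rewrite size_cat size_perfect_run sz.
- by rewrite /perfect_run -catA perfect_run_defects.
- by rewrite map_cat sumn_cat weight_perfect_run.
Qed.

Lemma knodel_unstable_family n m x :
    n./2 = 7 + (5 * m + size x) -> 8 <= n./2 ->
    word_defects perfect_window (x ++ perfect_window) = 1 ->
    (forall k e, 5 * k = n./2 * 2 + e -> ~~ excluded (n./2, (0, e)) ->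
       2 + (2 * m + sumn (map weight x)) < k) ->
  ~ gamma_stable (knodel_adj 4 n).
Proof.
move=> sz N_ge8 def1 lb.
apply: (@knodel_unstable n perfect_window (perfect_run m x)) => //.
- by rewrite size_cat size_perfect_run sz.
- by rewrite /perfect_run -catA perfect_run_defects.
- by rewrite map_cat sumn_cat weight_perfect_run.
Qed.

Theorem theorem4p6 (n : nat) :
  16 <= n -> ~~ odd n ->
  (gamma_stable (knodel_adj 4 n) <->
    [\/ n \in [:: 18; 28],
        (n %% 10 == 0) || (n %% 10 == 4)
      | (n != 26) && (n %% 10 == 6)]).
Proof.
move=> n_ge16 even_n.
have nE : n = n./2.*2 by rewrite even_halfK.
have N_ge8 : 8 <= n./2 by lia.
pose q := n./2 %/ 5.
have rE : n./2 = 5 * q + n./2 %% 5 by rewrite /q; lia.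
have [small|regular] := boolP (n./2 \in [:: 8; 9; 13; 14; 18]).
  have : [\/ n = 16, n = 18, n = 26 | n = 28 \/ n = 36].
    by move: small; rewrite !inE => /or4P[/eqP|/eqP|/eqP|/orP[] /eqP] E;
      rewrite nE E; [constructor 1|constructor 2|constructor 3|constructor 4; left|
                     constructor 4; right].
  case=> [n_eq|n_eq|n_eq|[n_eq|n_eq]]; subst n; split=> //.
  - by move=> _; constructor 3.
  - by move=> _; exact: (@knodel_stable_sporadic 16 [:: la; la; lo; lo; lo; lb; lb] [:: lo]).
  - by move=> _; constructor 1.
  - by move=> _; exact: (@knodel_stable_sporadic 18 [:: la; la; lo; lo; lo; lb; lb] [:: lo; lo]).
  - suff unst : ~ gamma_stable (knodel_adj 4 26) by move/unst.
    apply: (@knodel_unstable 26 [:: la; la; la; lo; lo; lo; lb]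
              [:: lo; lo; la; lo; lb; lo]) => // k e.
    rewrite -[5 * k]addn0; exact: (@size_excludedP 13 7 0 k e isT).
  - by case.
  - by move=> _; constructor 1.
  - move=> _; exact: (@knodel_stable_sporadic 28 [:: la; la; la; lo; lo; la; lo]
                        [:: lo; lo; lo; lb; lb; lo; lb]).
  - by move=> _; constructor 3.
  - move=> _; exact: (@knodel_stable_sporadic 36 [:: la; la; lo; lo; lo; lb; lb]
                        [:: lo; lo; la; la; lo; lo; lo; lb; lb; lo; lo]).
have q_ge2 : 2 <= q by move: regular; rewrite !inE; lia.
have exE := excluded_regular _ _ regular.
have lt_r := ltn_pmod n./2 (isT : 0 < 5).
move: (n./2 %% 5) rE lt_r => [|[|[|[|[|]]]]] // rE _.
- have st : gamma_stable (knodel_adj 4 n).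
    apply: (@knodel_stable_family n (q - 2) [:: lb; la; lo]) => //=; first lia.
    by move=> k d e d_le1 kE _; rewrite /weight /=; lia.
  by split=> // _; constructor 2; lia.
- have unst : ~ gamma_stable (knodel_adj 4 n).
    apply: (@knodel_unstable_family n (q - 2) [:: lb; lb; la; lo]) => //=; first lia.
    by move=> k e kE; rewrite exE /weight /= !inE; lia.
  by split=> // -[]; rewrite ?inE; lia.
- have st : gamma_stable (knodel_adj 4 n).
    apply: (@knodel_stable_family n (q - 2) [:: lb; lb; la; la; lo]) => //=; first lia.
    by move=> k [|[|d]] e d_le1 kE; rewrite exE /weight //= !inE; lia.
  by split=> // _; constructor 2; lia.
- have st : gamma_stable (knodel_adj 4 n).
    apply: (@knodel_stable_family n (q - 2) [:: lb; lb; lb; la; la; lo]) => //=; first lia.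
    by move=> k [|[|d]] e d_le1 kE; rewrite exE /weight //= !inE; lia.
  by split=> // _; constructor 3; move: regular; rewrite !inE; lia.
- have q_ge3 : 3 <= q by move: regular; rewrite !inE; lia.
  have unst : ~ gamma_stable (knodel_adj 4 n).
    apply: (@knodel_unstable_family n (q - 2) [:: lb; lb; lo; lo; lb; la; la]) => //=; first lia.
    by move=> k e kE; rewrite exE /weight /= !inE; lia.
  by split=> // -[]; rewrite ?inE; move: regular; rewrite ?inE; lia.
Qed.
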